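(* Let $C\subseteq\mathbb{F}_q^n$ be a constant weight linear code of dimension $k\geqslant1$ whose non-zero codewords all have weight $d$, and let $\mathbb{K}$ be any field. Then the minimal $\mathbb{N}$-graded free resolution of the Stanley-Reisner ring $R(C)$ of its associated matroid has the form \[ 0\leftarrow R(C)\leftarrow S\leftarrow P_1\leftarrow\cdots\leftarrow P_k\leftarrow 0, \qquad P_i=S(-d_i)^{{k\brack i}_q q^{\frac{i(i-1)}{2}}}\ (1\leqslant i\leqslant k), \] where $d_i=d\,\dfrac{q^i-1}{q^{i-1}(q-1)}$ for $1\leqslant i\leqslant k$.
   Context: A constant weight code is a linear code all of whose non-zero codewords have the same number of non-zero coordinates. Let $H_C$ be an $(n-k)\times n$ parity check matrix of $C$ ($c\in C$ iff $cH_C^t=0$); the associated matroid $\Delta$ on $\{1,\dots,n\}$ has as independent sets the index sets of linearly independent columns of $H_C$, and is regarded as a simplicial complex. With $S=\mathbb{K}[x_1,\dots,x_n]$ (standard $\mathbb{N}$-grading), the Stanley-Reisner ideal is $I_\Delta=\langle\prod_{e\in\sigma}x_e:\sigma\notin\Delta\rangle$ and $R(C)=S/I_\Delta$. $S(-j)$ denotes the free module of rank one generated in degree $j$. ${k\brack i}_q=\frac{f(k,q)}{f(i,q)f(k-i,q)}$ with $f(m,q)=\prod_{j=1}^m(q^j-1)$ is the Gaussian binomial coefficient. *)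

(* Defs.v *)
From HB Require Import structures.
From mathcomp Require Import all_boot all_order all_algebra all_field.
From mathcomp Require Import mpoly.
Set Implicit Arguments.
Unset Strict Implicit.
Unset Printing Implicit Defensive.
Import Order.TTheory GRing.Theory Num.Theory.
Local Open Scope ring_scope.

Definition wt (F : fieldType) (n : nat) (c : 'rV[F]_n) : nat :=
  #|[set i : 'I_n | c 0 i != 0]|.

Definition mat_indep (F : fieldType) (m n : nat) (H : 'M[F]_(m, n))
    (sigma : {set 'I_n}) : bool :=
  free [seq col j H | j <- enum sigma].

Definition sq_monomial (K : fieldType) (n : nat) (sigma : {set 'I_n})
  : {mpoly K[n]} := \prod_(e in sigma) 'X_e.

Definition SR_gens (F K : fieldType) (m n : nat) (H : 'M[F]_(m, n))
  : seq {mpoly K[n]} :=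
  [seq sq_monomial K sigma | sigma <- enum [set sigma : {set 'I_n} | ~~ mat_indep H sigma]].

Definition in_ideal (K : fieldType) (n : nat) (G : seq {mpoly K[n]})
    (p : {mpoly K[n]}) : Prop :=
  exists coefs : 'I_(size G) -> {mpoly K[n]},
    p = \sum_(j < size G) coefs j * nth 0 G j.

(* A finite graded free complex over S = K[x_1..x_n]:
   P_i = \bigoplus_{c < size (shifts i)} S(- nth 0 (shifts i) c);
   maps i r c = entry (r, c) of the matrix of d_i : P_i -> P_{i-1}
   (acting on column vectors; r indexes the basis of P_{i-1},
   c indexes the basis of P_i), for i >= 1. *)
Record gr_complex (K : fieldType) (n : nat) := GrComplex {
  shifts : nat -> seq nat;
  maps : nat -> nat -> nat -> {mpoly K[n]}
}.

Definition apply_d (K : fieldType) (n : nat) (P : gr_complex K n) (i : nat)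
    (v : nat -> {mpoly K[n]}) (r : nat) : {mpoly K[n]} :=
  \sum_(c < size (shifts P i)) maps P i r c * v c.

(* P is a minimal N-graded free resolution of S / I, where I is the
   ideal generated by G:
   - P_0 = S (one generator in degree 0), P_i = 0 for i large;
   - each d_i is homogeneous of degree 0 (entry (r,c) is homogeneous
     of degree shift_i(c) - shift_{i-1}(r), and zero unless
     shift_{i-1}(r) <= shift_i(c));
   - minimality: all entries lie in the irrelevant ideal (zero constant term);
   - image d_1 = I (so coker d_1 = S/I);
   - exactness at P_i, i >= 1: ker d_i = im d_{i+1}. *)
Definition is_min_gr_res (K : fieldType) (n : nat) (G : seq {mpoly K[n]})
    (P : gr_complex K n) : Prop :=
  [/\ shifts P 0 = [:: 0%N],
      (exists L : nat, forall i, (L < i)%N -> shifts P i = [::]),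
      (forall i r c, (0 < i)%N -> (r < size (shifts P i.-1))%N ->
          (c < size (shifts P i))%N ->
          [/\ maps P i r c \is (nth 0%N (shifts P i) c - nth 0%N (shifts P i.-1) r)%N.-homog,
              maps P i r c != 0 ->
                (nth 0%N (shifts P i.-1) r <= nth 0%N (shifts P i) c)%N &
              (maps P i r c)@_0%MM = 0]),
      (forall p : {mpoly K[n]},
          (exists v, p = apply_d P 1 v 0) <-> in_ideal G p) &
      (forall i, (0 < i)%N -> forall w : nat -> {mpoly K[n]},
          (forall r, (r < size (shifts P i.-1))%N -> apply_d P i w r = 0) <->
          (exists v, forall c, (c < size (shifts P i))%N ->
                       w c = apply_d P i.+1 v c))].

Definition fq (m q : nat) : rat := \prod_(1 <= j < m.+1) ((q%:Q) ^+ j - 1).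

Definition gauss_binom (k i q : nat) : rat := fq k q / (fq i q * fq (k - i) q).

(* Main.v *)
Require Import Defs.
From HB Require Import structures.
From mathcomp Require Import all_boot all_order all_algebra all_field.
From mathcomp Require Import mpoly ring.
Import Order.TTheory GRing.Theory Num.Theory.
Set Implicit Arguments.
Unset Strict Implicit.
Unset Printing Implicit Defensive.
Local Open Scope ring_scope.

(** The ideal is generated by the monomials [x^supp(c)], one for each line of
    the code [C]. Identify [C] with [F^k] and let the level of a line be the
    position [j < k] of its last nonzero coordinate; there are [q^j] lines of
    level [j]. The sets of lines with pairwise distinct levels are the sets
    without broken circuit for an ordering of the lines by level, and the
    simplicial complex they form supports a free resolution, which is the one of
    Lyubeznik: in multidegree [m] only the lines of the subcode of words supported
    in [supp(m)] matter, this subcode has a unique line of lowest level, and the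
    faces formed by its lines are a cone over that line.
    A face with [i] lines spans a subcode of dimension [i]; counting the pairs
    (word, nonzero coordinate) of this subcode shows that its support has [d_i]
    elements. As [d_i] is strictly increasing, the resolution is minimal. The
    number of faces with [i] lines is the elementary symmetric function of degree
    [i] of [1, q, ..., q^(k-1)], given by the q-binomial theorem. Finally, two
    minimal graded resolutions are related by graded chain maps that are inverse
    to each other modulo the irrelevant ideal, hence have the same shifts. *)

(** * Uniqueness of minimal graded resolutions *)

Section Restriction.

Variables (K : fieldType) (n : nat).
Implicit Types (P : pred 'X_{1..n}) (p : {mpoly K[n]}).

Definition mrestrict P p : {mpoly K[n]} :=
  \sum_(m <- msupp p | P m) p@_m *: 'X_[m].

Lemma mcoeff_mrestrict P p m : (mrestrict P p)@_m = if P m then p@_m else 0.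
Proof.
rewrite /mrestrict raddf_sum /=.
under eq_bigr do rewrite mcoeffZ mcoeffX.
have [pm|pm] := boolP (m \in msupp p); last first.
  rewrite (memN_msupp_eq0 pm) if_same big_seq_cond big1 // => m' /andP[pm' _].
  by case: eqP => [em|_]; [rewrite -em pm' in pm | rewrite mulr0].
rewrite big_mkcond (bigD1_seq m) ?msupp_uniq //= eqxx mulr1 big1 ?addr0 //.
by move=> m' /negPf->; rewrite mulr0 if_same.
Qed.

Lemma mcoeffM_ex p1 p2 m : (p1 * p2)@_m != 0 ->
  exists m1 m2, [/\ p1@_m1 != 0, p2@_m2 != 0 & m = (m1 + m2)%MM].
Proof.
rewrite -mcoeff_msupp => /msuppM_le /allpairsP[[m1 m2] /= []].
by rewrite !mcoeff_msupp => ? ? ->; exists m1, m2.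
Qed.

End Restriction.

(** * Graded matrices and reduction modulo the irrelevant ideal *)

Section Graded.

Variables (K : fieldType) (n : nat).
Local Notation S := {mpoly K[n]}.

Lemma mulmx_mcoeff_ex (a b c : nat) (A : 'M[S]_(a, b)) (B : 'M[S]_(b, c)) i j m :
  ((A *m B) i j)@_m != 0 -> exists l m1 m2,
    [/\ (A i l)@_m1 != 0, (B l j)@_m2 != 0 & m = (m1 + m2)%MM].
Proof.
rewrite mxE raddf_sum /= => nz.
have [l /mcoeffM_ex[m1 [m2 ?]]|all0] :=
  pickP (fun l => (A i l * B l j)@_m != 0); first by exists l, m1, m2.
by rewrite big1 ?eqxx // in nz => l _; apply/eqP; rewrite -[_ == _]negbK all0.
Qed.

(* Homogeneous maps of degree 0 from the free module with shifts [b] to the one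
   with shifts [a]. *)
Definition graded_mx (a b : seq nat) (A : 'M[S]_(size a, size b)) : Prop :=
  forall r c m, (A r c)@_m != 0 -> (mdeg m + nth 0 a r = nth 0 b c)%N.

Lemma graded_mulmx (a b c : seq nat) (A : 'M[S]_(size a, size b))
    (B : 'M[S]_(size b, size c)) :
  graded_mx A -> graded_mx B -> graded_mx (A *m B).
Proof.
move=> gA gB r t m /mulmx_mcoeff_ex[l [m1 [m2 [/gA e1 /gB e2 ->]]]].
by rewrite mdegD addnAC e1 addnC.
Qed.

(** The factor [A] may mix degrees. [A'] keeps the terms whose degree the shifts dictate; the
    discarded ones contribute to [D *m A] only in degrees where [B] has no terms. *)
Lemma graded_factor (a b c : seq nat) (D : 'M[S]_(size a, size b))
    (A : 'M[S]_(size b, size c)) (B : 'M[S]_(size a, size c)) :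
  graded_mx D -> graded_mx B -> B = D *m A ->
  exists2 A', graded_mx A' & B = D *m A'.
Proof.
move=> gD gB eB.
pose A' : 'M[S]_(size b, size c) := \matrix_(i, j)
  mrestrict (fun m => mdeg m + nth 0 b i == nth 0 c j)%N (A i j).
have gA' : graded_mx A'.
  by move=> r t m; rewrite mxE mcoeff_mrestrict; case: ifP => [/eqP|]; rewrite ?eqxx.
exists A' => //; apply/matrixP => r t; apply/mpolyP => m; apply/eqP.
rewrite -subr_eq0 -mcoeffB.
have -> : B r t - (D *m A') r t = (D *m (A - A')) r t.
  by rewrite mulmxBr -eB [in RHS]mxE [X in _ = _ + X]mxE.
have [//|nz] := eqVneq ((D *m (A - A')) r t)@_m 0.
have [l [m1 [m2 [/gD e1 nz2 em]]]] := mulmx_mcoeff_ex nz.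
have ne : (mdeg m + nth 0 a r != nth 0 c t)%N.
  apply: contra_neqN nz2 => /eqP; rewrite em mdegD addnAC e1 addnC => e2.
  by rewrite !mxE mcoeffB mcoeff_mrestrict e2 eqxx subrr.
have := nz; rewrite mulmxBr -eB mxE [X in _ + X]mxE mcoeffB => nz'.
have [B0|/gB eB'] := eqVneq (B r t)@_m 0; last by rewrite eB' eqxx in ne.
have [A0|/(graded_mulmx gD gA') eA'] := eqVneq ((D *m A') r t)@_m 0;
  last by rewrite eA' eqxx in ne.
by rewrite B0 A0 subrr eqxx in nz'.
Qed.

Definition mx0 (a b : nat) (A : 'M[S]_(a, b)) : 'M[K]_(a, b) :=
  map_mx (mcoeff 0%MM) A.

Lemma mx0M (a b c : nat) (A : 'M[S]_(a, b)) (B : 'M[S]_(b, c)) :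
  mx0 (A *m B) = mx0 A *m mx0 B.
Proof. exact: map_mxM. Qed.

(** The constant parts are inverse matrices over a field, so the ranks agree and no column of
    [mx0 f] vanishes; a nonzero constant entry of a graded matrix joins equal shifts. *)
Lemma graded_iso_shifts (a b : seq nat) (f : 'M[S]_(size b, size a))
    (g : 'M[S]_(size a, size b)) :
  graded_mx f -> mx0 (g *m f) = 1%:M -> mx0 (f *m g) = 1%:M ->
  size a = size b /\ {subset a <= b}.
Proof.
rewrite !mx0M => gf gf1 fg1; split.
  by apply/eqP; rewrite eqn_leq (mulmx1_min gf1) (mulmx1_min fg1).
move=> e /(nthP 0%N)[c lt_c <-].
have := congr1 (fun M : 'M__ => M (Ordinal lt_c) (Ordinal lt_c)) gf1.
rewrite !mxE eqxx => /eqP; rewrite -[_ == _]negbK => nz.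
have [r|f0] := pickP (fun r => (f r (Ordinal lt_c))@_0%MM != 0).
  by move/gf; rewrite mdeg0 add0n /= => <-; apply: mem_nth.
case/negP: nz; rewrite big1 => [|r _]; first by rewrite eq_sym oner_eq0.
by rewrite [mx0 f _ _]mxE; have /negbFE/eqP-> := f0 r; rewrite mulr0.
Qed.

End Graded.

(** * Comparison of two minimal resolutions of the same quotient *)

Section Comparison.

Variables (K : fieldType) (n : nat) (G : seq {mpoly K[n]}).
Local Notation S := {mpoly K[n]}.
Implicit Types P Q : gr_complex K n.

(** The index is that of the target: this is the differential from [P_(i+1)] to [P_i]. *)
Definition diff_mx P i : 'M[S]_(size (shifts P i), size (shifts P i.+1)) :=
  \matrix_(r, c) maps P i.+1 r c.

Definition vec_fun (m : nat) (v : 'I_m -> S) (c : nat) : S :=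
  if insub c is Some c' then v c' else 0.

Lemma vec_funE m (v : 'I_m -> S) (c : 'I_m) : vec_fun v c = v c.
Proof. by rewrite /vec_fun valK. Qed.

Lemma apply_dE P i (p : nat) (v : 'M[S]_(size (shifts P i.+1), p)) r c :
  (diff_mx P i *m v) r c = apply_d P i.+1 (vec_fun (v^~ c)) r.
Proof.
by rewrite mxE; apply: eq_bigr => l _; rewrite mxE vec_funE.
Qed.

Section Properties.

Variable P : gr_complex K n.
Hypothesis resP : is_min_gr_res G P.

Lemma res_exact i p (w : 'M[S]_(size (shifts P i.+1), p)) :
  diff_mx P i *m w = 0 -> exists v, w = diff_mx P i.+1 *m v.
Proof.
case: resP => _ _ _ _ /(_ i.+1 isT) ex /matrixP w0.
have {}ex c : exists v : 'cV[S]_(size (shifts P i.+2)),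
    col c w = diff_mx P i.+1 *m v.
  have [] := ex (vec_fun (w^~ c)).
  case=> [r lt_r|v ev _].
    by have := w0 (Ordinal lt_r) c; rewrite apply_dE mxE.
  exists (\col_l v l); apply/colP => l; rewrite apply_dE mxE -(vec_funE (w^~ c)) ev //.
  by apply: eq_bigr => t _; rewrite vec_funE mxE.
have [v ev] : exists v : 'I_p -> _, forall c, col c w = diff_mx P i.+1 *m v c.
  elim: p w {w0} ex => [|p IH] w ex.
    by exists (fun=> 0) => -[].
  have [v0 e0] := ex ord0.
  have [] := IH (\matrix_(r, c) w r (lift ord0 c)).
    move=> c; have [v ev] := ex (lift ord0 c); exists v; rewrite -ev.
    by apply/colP => r; rewrite !mxE.
  move=> v ev; exists (fun c => if unlift ord0 c is Some c' then v c' else v0) => c.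
  case: unliftP => [c' ->|-> //]; rewrite -ev.
  by apply/colP => r; rewrite !mxE.
exists (\matrix_(r, c) v c r 0); apply/matrixP => r c.
have := congr1 (fun M : 'cV_ _ => M r 0) (ev c); rewrite !mxE => ->.
by apply: eq_bigr => l _; rewrite !mxE.
Qed.

Lemma res_dd i : diff_mx P i *m diff_mx P i.+1 = 0.
Proof.
case: resP => _ _ _ _ /(_ i.+1 isT) ex; apply/matrixP => r c.
rewrite apply_dE mxE; case: (ex (vec_fun ((diff_mx P i.+1)^~ c))) => _; apply => //.
exists (fun l : nat => (l == c)%:R) => l lt_l;
  rewrite -[l]/(val (Ordinal lt_l)) vec_funE.
rewrite mxE /apply_d (bigD1 c) //= eqxx mulr1 big1 ?addr0 // => t.
by rewrite -val_eqE /= => /negPf->; rewrite mulr0.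
Qed.

Lemma res_graded i : graded_mx (diff_mx P i).
Proof.
case: resP => _ _ hom _ _ r c m; rewrite mxE => nz.
have [//|//|//|hom' le_sh _] := hom i.+1 r c.
rewrite (dhomog_mf hom') ?mcoeff_msupp //.
by rewrite subnK // le_sh //; apply: contra_neq nz => ->; rewrite mcoeff0.
Qed.

Lemma res_mx0 i : mx0 (diff_mx P i) = 0.
Proof.
case: resP => _ _ hom _ _; apply/matrixP => r c; rewrite !mxE.
by have [] := hom i.+1 r c.
Qed.

Lemma res_size0 : size (shifts P 0) = 1%N.
Proof. by case: resP => ->. Qed.

End Properties.

(** Both first differentials have the ideal as image, so each entry of that of [P] has a preimage in
    [Q]. As both modules in step 0 have rank one, [const_mx 1] is the identity of [S]. *)
Lemma res_lift0 P Q : is_min_gr_res G P -> is_min_gr_res G Q ->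
  exists A, const_mx 1 *m diff_mx P 0 = diff_mx Q 0 *m A.
Proof.
move=> resP resQ; have size0 := (res_size0 resP, res_size0 resQ).
have lift c : exists v : nat -> S, maps P 1 0 c = apply_d Q 1 v 0 \/
  (size (shifts P 1) <= c)%N.
  have [lt_c|le_c] := ltnP c (size (shifts P 1)); last by exists (fun=> 0); right.
  case: resP resQ => _ _ _ imP _ [_ _ _ imQ _].
  have [|v ev] := (imQ (maps P 1 0 c)).2; last by exists v; left.
  apply/imP; exists (fun l : nat => (l == c)%:R); rewrite /apply_d.
  rewrite (bigD1 (Ordinal lt_c)) //= eqxx mulr1 big1 ?addr0 // => t.
  by rewrite -val_eqE /= => /negPf->; rewrite mulr0.
have [v ev] : exists v : nat -> nat -> S, forall c, (c < size (shifts P 1))%N ->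
    maps P 1 0 c = apply_d Q 1 (v c) 0.
  elim: (size (shifts P 1)) lift => [|m IH] lift; first by exists (fun _ _ => 0).
  have [] := IH; first by move=> c; have [v [ev|lt_c]] := lift c;
    [exists v; left | exists v; right; apply: ltnW].
  move=> v ev; have [v' [ev'|]] := lift m; last by rewrite ltnn.
  exists (fun c => if c == m then v' else v c) => c.
  by rewrite ltnS leq_eqVlt; case: eqP => [-> //|_ /= /ev].
exists (\matrix_(r, c) v c r); apply/matrixP => r c.
rewrite [in RHS]mxE !mxE.
have r0 : r = 0%N :> nat by move: (ltn_ord r);
  rewrite [X in (_ < X)%N]size0.2 ltnS leqn0 => /eqP.
transitivity (maps P 1 0 c).
  have lt0 : (0 < size (shifts P 0))%N by rewrite size0.1.
  rewrite (bigD1 (Ordinal lt0)) //= !mxE mul1r big1 ?addr0 // => l.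
  rewrite -val_eqE /= => nl; move: (ltn_ord l) nl.
  by rewrite [X in (_ < X)%N]size0.1; case: (l : nat).
by rewrite ev //; apply: eq_bigr => l _; rewrite !mxE r0.
Qed.

Lemma const_mx11 (a b : nat) : a = 1%N -> b = 1%N ->
  const_mx 1 *m (const_mx 1 : 'M_(b, a)) = 1%:M :> 'M[S]_a.
Proof.
move=> a1 b1; subst a b; apply/matrixP => i j.
by rewrite !mxE big_ord1 !mxE mul1r !ord1 eqxx.
Qed.

(* The chain maps f : P -> Q and g : Q -> P lift the identity of S / I; they are
   built one degree at a time, together with homotopies from g f and f g to the
   identity. The homotopies show that g f and f g are the identity modulo the
   irrelevant ideal, as the differentials vanish there. *)
Lemma min_res_chain_maps P Q : is_min_gr_res G P -> is_min_gr_res G Q ->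
  forall i, exists (f : 'M[S]_(size (shifts Q i), size (shifts P i)))
    (g : 'M[S]_(size (shifts P i), size (shifts Q i))) f' g' h k,
  [/\ graded_mx f /\ diff_mx Q i *m f' = f *m diff_mx P i,
      diff_mx P i *m g' = g *m diff_mx Q i,
      mx0 (g *m f) = 1%:M /\ mx0 (f *m g) = 1%:M,
      (g *m f - 1%:M - diff_mx P i *m h) *m diff_mx P i = 0 &
      (f *m g - 1%:M - diff_mx Q i *m k) *m diff_mx Q i = 0].
Proof.
move=> resP resQ; have size0 := (res_size0 resP, res_size0 resQ).
elim=> [|i [f [g [f' [g' [h [k [[grf ef] eg _ eh ek]]]]]]]].
  have [f' ef] := res_lift0 resP resQ; have [g' eg] := res_lift0 resQ resP.
  exists (const_mx 1), (const_mx 1), f', g', 0, 0.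
  rewrite !const_mx11 ?size0 // !mulmx0 !subrr !mul0mx.
  split=> //; last by split; apply: map_mx1.
  split=> // r c m; rewrite mxE mcoeff1.
  have [-> _|_] := eqVneq m 0%MM; last by rewrite eqxx.
  have [[sP _ _ _ _] [sQ _ _ _ _]] := (resP, resQ).
  by move: r c; rewrite sP sQ => r c; rewrite mdeg0 !ord1.
(* [f'] comes from exactness alone and need not be homogeneous; [F] is a graded replacement. *)
have [F grF eF] := graded_factor (@res_graded _ resQ i)
  (graded_mulmx grf (@res_graded _ resP i)) (esym ef).
have lift (A : gr_complex K n) (resA : is_min_gr_res G A)
    (B : gr_complex K n) (resB : is_min_gr_res G B) u
    (u' : 'M[S]_(size (shifts B i.+1), size (shifts A i.+1))) :
    diff_mx B i *m u' = u *m diff_mx A i ->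
    exists u'', diff_mx B i.+1 *m u'' = u' *m diff_mx A i.+1.
  move=> eu; have [|u'' eu''] := res_exact resB (w := u' *m diff_mx A i.+1).
    by rewrite mulmxA eu -mulmxA (res_dd resA) mulmx0.
  by exists u''.
(* The differential kills [u' - 1%:M - l *m diff_mx A i], so exactness provides the next homotopy
   [l']. *)
have htpy (A : gr_complex K n) (resA : is_min_gr_res G A) (u : 'M_(size (shifts A i)))
    (u' : 'M_(size (shifts A i.+1))) (l : 'M_(size (shifts A i.+1), size (shifts A i))) :
    diff_mx A i *m u' = u *m diff_mx A i ->
    (u - 1%:M - diff_mx A i *m l) *m diff_mx A i = 0 ->
    exists l', u' - 1%:M - diff_mx A i.+1 *m l' = l *m diff_mx A i.
  move=> eu el; have [|l' el'] := res_exact resA (w := u' - 1%:M - l *m diff_mx A i).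
    by rewrite !mulmxBr eu mulmx1 -el !mulmxBl mul1mx mulmxA.
  by exists l'; rewrite -el' opprB addrC addrNK.
(* Each homotopy term contains a differential, whose entries have no constant term. *)
have unit (A : gr_complex K n) (resA : is_min_gr_res G A)
    (u' : 'M_(size (shifts A i.+1))) (l : 'M_(size (shifts A i.+1), size (shifts A i)))
    (l' : 'M_(size (shifts A i.+2), size (shifts A i.+1))) :
    u' - 1%:M - diff_mx A i.+1 *m l' = l *m diff_mx A i ->
    mx0 u' = 1%:M /\ (u' - 1%:M - diff_mx A i.+1 *m l') *m diff_mx A i.+1 = 0.
  move=> el; split; last by rewrite el -mulmxA (res_dd resA) mulmx0.
  have -> : u' = 1%:M + (l *m diff_mx A i + diff_mx A i.+1 *m l').
    by rewrite -el subrK addrC subrK.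
  by rewrite /mx0 !map_mxD map_mx1 -!/(mx0 _) !mx0M !(res_mx0 resA) mulmx0 mul0mx !addr0.
have [f'' ef''] := lift _ resP _ resQ _ _ (esym eF).
have [g'' eg''] := lift _ resQ _ resP _ _ eg.
have [|h' eh'] := htpy _ resP (g *m f) (g' *m F) h _ eh.
  by rewrite mulmxA eg -mulmxA -eF mulmxA.
have [|k' ek'] := htpy _ resQ (f *m g) (F *m g') k _ ek.
  by rewrite mulmxA -eF -mulmxA eg mulmxA.
have [gf1 gfh] := unit _ resP _ _ _ eh'; have [fg1 fgk] := unit _ resQ _ _ _ ek'.
by exists F, g', f'', g'', h', k'.
Qed.

Lemma min_res_shifts P Q : is_min_gr_res G P -> is_min_gr_res G Q ->
  forall i, size (shifts P i) = size (shifts Q i) /\ {subset shifts P i <= shifts Q i}.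
Proof.
move=> resP resQ i.
have [f [g [_ [_ [_ [_ [[grf _] _ [gf1 fg1] _ _]]]]]]] :=
  min_res_chain_maps resP resQ i.
exact: graded_iso_shifts grf gf1 fg1.
Qed.

End Comparison.

(** * The resolution supported on sets with distinct levels *)

Section SquareFree.

Variables (K : fieldType) (n : nat).
Implicit Types (X Y : {set 'I_n}) (m : 'X_{1..n}).

Definition mnm_supp m : {set 'I_n} := [set e | (0 < m e)%N].

Lemma sq_monomialE X : sq_monomial K X = 'X_[mesym1 X].
Proof.
rewrite mpolyXE_id /sq_monomial big_mkcond; apply: eq_bigr => e _.
by rewrite mnmE; case: (e \in X).
Qed.

Lemma mesym1_le X m : (mesym1 X <= m)%MM = (X \subset mnm_supp m).
Proof.
apply/mnm_lepP/subsetP => le e; first by have := le e; rewrite mnmE inE => h Xe;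
  move: h; rewrite Xe.
by rewrite mnmE; have := le e; rewrite inE; case: (e \in X) => // ->.
Qed.

Lemma mnm_supp_mesym1D X m : X \subset mnm_supp (mesym1 X + m).
Proof. by rewrite -mesym1_le; apply: lem_addr. Qed.

Lemma mesym1D X Y : X \subset Y -> (mesym1 X + mesym1 (Y :\: X))%MM = mesym1 Y.
Proof.
move/subsetP=> sXY; apply/mnmP => e; rewrite mnmDE !mnmE inE.
by have [/sXY->|] := boolP (e \in X).
Qed.

(** Exponents are subtracted with truncation: this is a quotient only if ['X_[m]] divides every
    monomial of [p]. *)
Definition mdiv_mnm m (p : {mpoly K[n]}) : {mpoly K[n]} :=
  \sum_(m' <- msupp p) p@_m' *: 'X_[m' - m].

Lemma mdiv_mnmK m (p : {mpoly K[n]}) : (forall m', p@_m' != 0 -> (m <= m')%MM) ->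
  'X_[m] * mdiv_mnm m p = p.
Proof.
move=> le_m; rewrite [RHS]mpolyE mulr_sumr; apply: eq_big_seq => m'.
by rewrite mcoeff_msupp => /le_m le; rewrite -scalerAr -mpolyXD addmC submK.
Qed.

End SquareFree.

(** * Simplicial chains with polynomial coefficients *)

Section TransversalComplex.

Variables (K : fieldType) (n : nat) (T : finType).
Variables (lev : T -> nat) (s : T -> {set 'I_n}).
Local Notation S := {mpoly K[n]}.
Implicit Types (A B : {set T}) (X : {set 'I_n}) (a b u : T) (V : {set T} -> S).

Definition face A : bool :=
  [forall a in A, forall b in A, (lev a == lev b) ==> (a == b)].

Definition union_supp A : {set 'I_n} := \bigcup_(a in A) s a.

Lemma faceP A : reflect {in A &, injective lev} (face A).
Proof.
apply: (iffP forall_inP) => [inj a b Aa Ab e|inj a Aa].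
  by have /forall_inP/(_ b Ab) := inj a Aa; rewrite e eqxx => /eqP.
by apply/forall_inP => b Ab; apply/implyP => /eqP/inj->.
Qed.

Lemma faceS A B : A \subset B -> face B -> face A.
Proof.
move=> /subsetP sAB /faceP inj; apply/faceP => a b /sAB Ba /sAB Bb; exact: inj.
Qed.

Lemma faceU1 a B : face B -> (forall b, b \in B -> lev b = lev a -> b = a) ->
  face (a |: B).
Proof.
move=> /faceP inj uniq_a; apply/faceP => b c.
by rewrite !inE => /predU1P[->|Bb] /predU1P[->|Bc] // e;
  [rewrite (uniq_a c) | apply: uniq_a | apply: inj].
Qed.

Lemma faceD1 A a : face A -> face (A :\ a).
Proof. exact/faceS/subD1set. Qed.

Lemma union_suppS A B : A \subset B -> union_supp A \subset union_supp B.
Proof.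
move=> /subsetP sAB; apply/bigcupsP => a /sAB; exact: bigcup_sup.
Qed.

Lemma union_suppU1 a B : union_supp (a |: B) = s a :|: union_supp B.
Proof. by rewrite /union_supp bigcup_setU big_set1. Qed.

(** Levels are distinct on a face, so ordering vertices by level gives the usual simplicial sign. *)
Definition sgn a B : K := (-1) ^+ #|[set b in B | (lev b < lev a)%N]|.

Lemma sgnU1 a b B : a \notin B ->
  sgn b (a |: B) = (-1) ^+ (lev a < lev b)%N * sgn b B.
Proof.
move=> aB; rewrite /sgn -exprD; congr (_ ^+ _).
rewrite (cardsD1 a) !inE eqxx; congr (_ + _)%N; apply: eq_card => c.
by rewrite !inE; have [->|//] := eqVneq c a; rewrite (negPf aB) /= ?andbF.
Qed.

Lemma sgn_sqr a B : sgn a B * sgn a B = 1.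
Proof. by rewrite /sgn -expr2 sqrr_sign. Qed.

(** The coefficient at [B] of the boundary of the chain [V], in the augmented complex: [B] may be
    empty. *)
Definition boundary V B : S :=
  \sum_(a | (a \notin B) && face (a |: B)) sgn a B *: V (a |: B).

Lemma face_lev_neq a b B : b \notin a |: B -> face (b |: (a |: B)) ->
  lev a != lev b.
Proof.
rewrite !inE negb_or => /andP[nba _] /faceP inj; apply: contraNneq nba => e.
by rewrite (inj b a) // !inE eqxx ?orbT.
Qed.

(** Adding [a] then [b], or [b] then [a], reaches the same face with opposite signs, as exactly one
    of the two levels is the smaller. *)
Lemma boundaryK V B : boundary (boundary V) B = 0.
Proof.
pose c a b := [&& a \notin B, b \notin a |: B & face (b |: (a |: B))].
pose t a b : S := if c a b then (sgn a B * sgn b B) *: V (b |: (a |: B)) else 0.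
have tC a b : t a b = t b a.
  rewrite /t /c [b |: (a |: B)]setUCA !inE !negb_or [b == a]eq_sym mulrC.
  by rewrite (andbCA (a \notin B)) -!andbA; case: (a != b);
    rewrite //= ?andbF // andbCA.
transitivity (\sum_a \sum_b (-1) ^+ (lev a < lev b)%N *: t a b).
  rewrite /boundary big_mkcond; apply: eq_bigr => a _; case: ifPn =>
    [/andP[aB faB]|naB].
    rewrite scaler_sumr big_mkcond; apply: eq_bigr => b _.
    rewrite /t /c aB; case: ifP => _; last by rewrite scaler0.
    by rewrite (sgnU1 _ aB) !scalerA mulrCA mulrA.
  rewrite big1 // => b _; rewrite /t; case: ifP => [/and3P[aB _ fab]|];
    last by rewrite scaler0.
  by rewrite aB (faceS _ fab) ?subsetUr in naB.
have -> : \sum_a \sum_b (-1) ^+ (lev a < lev b)%N *: t a b =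
    \sum_a \sum_(b | (lev b < lev a)%N) t a b - \sum_a \sum_(b | (lev a < lev b)%N) t a b.
  rewrite -sumrB; apply: eq_bigr => a _.
  rewrite (bigID (fun b => lev a < lev b)%N) /= addrC; congr (_ + _).
    rewrite [LHS]big_mkcond [RHS]big_mkcond; apply: eq_bigr => b _;
      rewrite -leqNgt leq_eqVlt.
    case: ltngtP => [lt|gt|e]; rewrite ?expr0 ?scale1r // /t /c.
    by case: ifP => // /and3P[_ nb /(face_lev_neq nb)]; rewrite e eqxx.
  by rewrite -sumrN; apply: eq_bigr => b ->; rewrite expr1 scaleN1r.
rewrite [X in _ - X](exchange_big_dep xpredT) //=.
by under [X in _ - X]eq_bigr do under eq_bigr do rewrite tC; rewrite subrr.
Qed.

(** The cone point for multidegrees of support [X]: being alone in its level there, it can be added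
    to any face whose vertices are supported in [X]. *)
Definition apex X : option T :=
  [pick a | (s a \subset X) &&
     [forall u, (s u \subset X) && (lev u == lev a) ==> (u == a)]].

(** The contracting homotopy, taken monomial by monomial because the apex depends on the support of
    the monomial. *)
Definition cone V A : S :=
  \sum_(a in A) sgn a A *: mrestrict (fun m =>
    apex (mnm_supp m) == Some a) (V (A :\ a)).

Lemma apexP X a : apex X = Some a ->
  s a \subset X /\ forall u, s u \subset X -> lev u = lev a -> u = a.
Proof.
rewrite /apex; case: pickP => // a' /andP[sa /forallP un] [<-]; split=> // u su e.
by have := un u; rewrite su e eqxx => /eqP.
Qed.

Lemma mcoeff_cone V A m : (cone V A)@_m =
  if apex (mnm_supp m) is Some a then
    if a \in A then sgn a A * (V (A :\ a))@_m else 0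
  else 0.
Proof.
rewrite /cone raddf_sum /=.
under eq_bigr do rewrite mcoeffZ mcoeff_mrestrict.
case: (apex _) => [a|]; last by rewrite big1 // => a _; rewrite mulr0.
have [Aa|nAa] := boolP (a \in A).
  rewrite (bigD1 a) //= eqxx big1 ?addr0 // => b /andP[_ nba].
  by rewrite (inj_eq Some_inj) eq_sym (negPf nba) mulr0.
rewrite big1 // => b Ab; rewrite (inj_eq Some_inj); case: eqP => [e|_];
  rewrite ?mulr0 //.
by rewrite e Ab in nAa.
Qed.

(** This makes the cone divisible by the monomial of [union_supp A]. *)
Lemma cone_supp V A m : face A ->
  (forall a, a \in A -> (V (A :\ a))@_m != 0 ->
    union_supp (A :\ a) \subset mnm_supp m) ->
  (cone V A)@_m != 0 -> union_supp A \subset mnm_supp m.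
Proof.
move=> fA suppV; rewrite mcoeff_cone.
case e: (apex _) => [a|]; last by rewrite eqxx.
case: ifP => [Aa|_]; last by rewrite eqxx.
rewrite mulf_eq0 negb_or => /andP[_ /suppV sub].
by rewrite -(setD1K Aa) union_suppU1 subUset sub // (apexP e).1.
Qed.

Hypothesis apex_ex : forall X u, s u \subset X -> apex X != None.

(* In the multidegree [m], the faces [A] with [union_supp A] inside the support
   of [m] form a cone over [apex (mnm_supp m)]. *)
Lemma boundary_cone i V :
  (forall A m, face A -> #|A| = i -> (V A)@_m != 0 ->
     union_supp A \subset mnm_supp m /\ exists u, s u \subset mnm_supp m) ->
  (forall B, face B -> #|B|.+1 = i -> boundary V B = 0) ->
  forall A, face A -> #|A| = i -> boundary (cone V) A = V A.
Proof.
move=> suppV cycV A fA cA; apply/mpolyP => m.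
rewrite /boundary raddf_sum /=.
under eq_bigr do rewrite mcoeffZ mcoeff_cone.
case e: (apex _) => [a0|]; last first.
  rewrite big1 => [|a _]; last by rewrite mulr0.
  apply/esym/eqP; case: eqVneq => // /(suppV _ _ fA cA)[_ [u /apex_ex]].
  by rewrite e.
have [sa0 unique] := apexP e.
have V0 B b : face B -> #|B| = i -> b \in B -> b != a0 -> lev b = lev a0 ->
  (V B)@_m = 0.
  move=> fB cB Bb nb el; apply/eqP; apply: contraNT nb => /(suppV _ _ fB cB)[sub _].
  apply/eqP/unique => //; apply: subset_trans sub; exact: bigcup_sup.
(* If the apex lies in [A], the cycle condition at [A :\ a0] expresses [V A] through the other faces
   containing [A :\ a0], which are the terms of the boundary of the cone. *)
have [Aa0|nAa0] := boolP (a0 \in A).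
  have e0 : (boundary V (A :\ a0))@_m = 0.
    by rewrite cycV ?mcoeff0 ?faceD1 // -cA [in RHS](cardsD1 a0) Aa0.
  rewrite /boundary raddf_sum /= (bigD1 a0) /= in e0; last first.
    by rewrite !inE eqxx setD1K.
  move: e0; rewrite setD1K // mcoeffZ => /eqP; rewrite addr_eq0 => /eqP e0.
  have -> : (V A)@_m = sgn a0 (A :\ a0) * (sgn a0 (A :\ a0) * (V A)@_m).
    by rewrite mulrA sgn_sqr mul1r.
  rewrite e0 -sumrN mulr_sumr [LHS]big_mkcond [RHS]big_mkcond; apply: eq_bigr => a _.
  rewrite !inE Aa0 orbT; have [->|na] := eqVneq a a0; first by rewrite Aa0 andbF.
  have [Aa|nAa] /= := boolP (a \in A); first by [].
  have eA : (a |: A) :\ a0 = a |: (A :\ a0).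
    by apply/setP => x; rewrite !inE; case: eqVneq => [->|//];
      rewrite eq_sym (negPf na).
  have [fa|nfa] := boolP (face (a |: A)).
    have -> /= : face (a |: A :\ a0) by rewrite -eA faceD1.
    have nl : (lev a != lev a0).
      by apply: contraNneq na => /(faceP _ fa)->; rewrite ?inE ?eqxx ?Aa0 ?orbT.
    have sgn_aA : sgn a A = (-1) ^+ (lev a0 < lev a)%N * sgn a (A :\ a0).
      by rewrite -sgnU1 ?setD1K // !inE eqxx.
    have sgn_a0A : sgn a0 A = sgn a0 (A :\ a0).
      by rewrite -{1}(setD1K Aa0) sgnU1 ?ltnn ?mul1r // !inE eqxx.
    rewrite mcoeffZ eA sgnU1 // sgn_a0A sgn_aA mulrN !mulrA -mulNr; congr (_ * _).
    by case: ltngtP nl => // _ _; rewrite ?expr0 ?expr1; ring.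
  (* Only a vertex [a] in the level of [a0] reaches this case, and [V0] kills its term. *)
  case: ifP => // /andP[fa _];
    rewrite mcoeffZ (V0 _ a) ?setU11 // ?mulr0 ?oppr0 ?mulr0 //.
    by rewrite -cA cardsU1 (cardsD1 a0 A) Aa0 !inE na (negPf nAa).
  apply/eqP; apply: contraNT nfa => nl; apply: faceU1 => // b Ab el.
  have [eb|nb] := eqVneq b a0; first by rewrite -el eb eqxx in nl.
  by apply: (faceP _ fa); rewrite // !inE ?eqxx ?nb ?Ab ?orbT.
(* If [a0] can be added to [A], only the summand [a = a0] survives. If not, some vertex of [A]
   shares the level of [a0], and both sides vanish. *)
have [fa|nfa] := boolP (face (a0 |: A)).
  rewrite (bigD1 a0) /=; last by rewrite nAa0.
  rewrite !inE eqxx setU1K // sgnU1 // ltnn mul1r mulrA sgn_sqr mul1r big1 ?addr0 //.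
  by move=> a /andP[_ na]; rewrite !inE eq_sym (negPf na) (negPf nAa0) mulr0.
rewrite big1 => [|a /andP[nAa fa]].
  apply/esym; have [b /andP[Ab /eqP el]|uniq_a0] := pickP (fun b =>
    (b \in A) && (lev b == lev a0)).
    by apply: (V0 _ b) => //; apply: contraNneq nAa0 => <-.
  by case/negP: nfa; apply: faceU1 => // b Ab el; have := uniq_a0 b; rewrite Ab el eqxx.
rewrite !inE; case: eqVneq => [ea|_]; first by rewrite ea fa in nfa.
by rewrite (negPf nAa0) mulr0.
Qed.

Lemma eq_boundary V V' B :
  (forall a, a \notin B -> face (a |: B) -> V (a |: B) = V' (a |: B)) ->
  boundary V B = boundary V' B.
Proof. by move=> eV; apply: eq_bigr => a /andP[aB fB]; rewrite eV. Qed.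

Definition faces i : seq {set T} := enum [set A | face A & #|A| == i].

Lemma mem_faces A i : (A \in faces i) = face A && (#|A| == i).
Proof. by rewrite mem_enum inE. Qed.

Lemma faces0 : faces 0 = [:: set0].
Proof.
rewrite /faces -(enum_set1 (set0 : {set T})).
suff -> : [set A | face A & #|A| == 0%N] = [set set0] by [].
apply/setP => A; rewrite !inE cards_eq0; case: eqP => [->|]; rewrite ?andbF ?andbT //.
by apply/faceP => a; rewrite inE.
Qed.

Lemma faces_nthP i c : (c < size (faces i))%N ->
  face (nth set0 (faces i) c) /\ #|nth set0 (faces i) c| = i.
Proof. by move/(mem_nth set0); rewrite mem_faces => /andP[? /eqP]. Qed.

(** At most one [a] satisfies the condition, so the sum is a signed monomial or zero. *)
Definition trans_entry B A : S :=
  \sum_(a | (a \notin B) && (A == a |: B))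
     sgn a B *: 'X_[mesym1 (union_supp A :\: union_supp B)].

(** The generator at [A] has the degree of the least common multiple of the monomials of its
    vertices. *)
Definition trans_complex : gr_complex K n :=
  GrComplex (fun i => [seq #|union_supp A| | A <- faces i])
    (fun i r c => trans_entry (nth set0 (faces i.-1) r) (nth set0 (faces i) c)).

Local Notation xsupp A := ('X_[mesym1 (union_supp A)] : S).

(* Multiplying the coordinate at each face [A] by [xsupp A] turns the
   differential into the simplicial boundary. *)
Lemma apply_trans_complex i (v : nat -> S) r : (r < size (faces i))%N ->
  xsupp (nth set0 (faces i) r) * apply_d trans_complex i.+1 v r =
  boundary (fun A => xsupp A * v (index A (faces i.+1))) (nth set0 (faces i) r).
Proof.
move=> lt_r; set B := nth _ _ r.
have -> : apply_d trans_complex i.+1 v r =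
    \sum_(A <- faces i.+1) trans_entry B A * v (index A (faces i.+1)).
  rewrite (big_nth set0) big_mkord /apply_d /= size_map.
  by apply: eq_bigr => c _; rewrite index_uniq ?enum_uniq.
rewrite mulr_sumr big_enum_cond /=.
under eq_bigr do rewrite mulrA mulr_sumr mulr_suml.
rewrite (exchange_big_dep (fun a => a \notin B)) /=; last by move=> A a _ /andP[].
rewrite [RHS]big_mkcondr; apply: eq_bigr => a nBa; rewrite nBa /=.
have [fB cB] : face B /\ #|B| = i := faces_nthP lt_r.
case: ifPn => [fa|nfa].
  rewrite (big_pred1 (a |: B)) => [|A].
    rewrite -scalerAr -scalerAl -mpolyXD mesym1D //; exact/union_suppS/subsetUr.
  rewrite !inE /=; case: (A =P a |: B) => [->|]; rewrite ?andbF // fa cardsU1 nBa cB.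
  by rewrite add1n eqxx.
rewrite big_pred0 // => A; case: (A =P a |: B) => [->|]; rewrite ?andbF // inE.
by rewrite (negPf nfa).
Qed.

Lemma xsupp_mulI A : injective ( *%R (xsupp A)).
Proof.
apply/mulfI; apply/eqP => /(congr1 (mcoeff (mesym1 (union_supp A)))).
by rewrite mcoeffX mcoeff0 eqxx => /eqP; rewrite oner_eq0.
Qed.

Lemma xsupp_mul_supp A (p : S) m : (xsupp A * p)@_m != 0 ->
  union_supp A \subset mnm_supp m.
Proof.
case/mcoeffM_ex => m1 [m2 []]; rewrite -mcoeff_msupp => /mem_msuppXP<- _ ->.
exact: mnm_supp_mesym1D.
Qed.

Lemma trans_complex_exact i (w : nat -> S) :
  (forall r, (r < size (shifts trans_complex i))%N ->
    apply_d trans_complex i.+1 w r = 0) <->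
  (exists v, forall c, (c < size (shifts trans_complex i.+1))%N ->
     w c = apply_d trans_complex i.+2 v c).
Proof.
rewrite /= !size_map.
pose V A := xsupp A * w (index A (faces i.+1)).
have face_nth j A : face A -> #|A| = j ->
    (index A (faces j) < size (faces j))%N /\ nth set0 (faces j) (index A (faces j)) = A.
  move=> fA cA; have memA : A \in faces j by rewrite mem_faces fA cA eqxx.
  by rewrite index_mem nth_index.
have nthK j c : (c < size (faces j))%N -> index (nth set0 (faces j) c) (faces j) = c.
  by move=> lt_c; rewrite index_uniq // enum_uniq.
split=> [w0|[v ev] r lt_r]; last first.
  have [fB cB] := faces_nthP lt_r.
  apply: (@xsupp_mulI (nth set0 (faces i) r)); rewrite mulr0 apply_trans_complex //.
  rewrite -[RHS](boundaryK (fun A => xsupp A * v (index A (faces i.+2)))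
    (nth set0 (faces i) r)).
  apply: eq_boundary => a nBa fa.
  have [||lt_a ea] := face_nth i.+1 (a |: nth set0 (faces i) r) => //.
    by rewrite cardsU1 nBa cB.
  by rewrite ev // -{1}ea apply_trans_complex // ea.
have cycV B : face B -> #|B|.+1 = i.+1 -> boundary V B = 0.
  move=> fB [cB]; have [lt_r eB] := face_nth i B fB cB.
  by have := apply_trans_complex w lt_r; rewrite w0 // mulr0 eB.
have suppV A m : face A -> #|A| = i.+1 -> (V A)@_m != 0 ->
    union_supp A \subset mnm_supp m /\ exists u, s u \subset mnm_supp m.
  move=> _ cA /xsupp_mul_supp sub; split=> //.
  have /card_gt0P[u Au] : (0 < #|A|)%N by rewrite cA.
  by exists u; apply: subset_trans sub; apply: bigcup_sup.
(* The preimage is the cone over the rescaled cycle, divided by the rescaling monomial; [cone_supp]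
   makes the division exact. *)
pose v c := let A := nth set0 (faces i.+2) c in
  mdiv_mnm (mesym1 (union_supp A)) (cone V A).
exists v => c lt_c; have [fA cA] := faces_nthP lt_c.
apply: (@xsupp_mulI (nth set0 (faces i.+1) c)); rewrite apply_trans_complex //.
have := boundary_cone suppV cycV fA cA; rewrite {2}/V nthK // => <-.
apply: eq_boundary => a nAa fa; set A' := a |: _ in fa *.
have cA' : #|A'| = i.+2 by rewrite cardsU1 nAa cA.
have [_ eA'] := face_nth _ _ fa cA'.
rewrite /v eA' mdiv_mnmK // => m nz; rewrite mesym1_le.
apply: (cone_supp fa _ nz) => b Ab nzb.
have [] // := suppV _ _ (faceD1 b fa) _ nzb.
by apply/eqP; rewrite -eqSS -cA' [X in _ == X](cardsD1 b) Ab.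
Qed.

Lemma trans_complex_ideal (dep : pred {set 'I_n}) :
  (forall X, dep X = [exists u, s u \subset X]) ->
  forall p : S, (exists v, p = apply_d trans_complex 1 v 0) <->
    in_ideal [seq sq_monomial K X | X <- enum [set X | dep X]] p.
Proof.
move=> depE p; set G := [seq _ | _ <- _].
have f0 : (0 < size (faces 0))%N by rewrite faces0.
have apply1 v : apply_d trans_complex 1 v 0 =
    boundary (fun A => xsupp A * v (index A (faces 1))) set0.
  have := apply_trans_complex v f0; rewrite faces0 /= => <-.
  rewrite /union_supp big_set0.
  suff -> : mesym1 (set0 : {set 'I_n}) = 0%MM by rewrite mpolyX0 mul1r.
  by apply/mnmP => e; rewrite !mnmE inE.
have depG m (q : S) j : (j < size G)%N -> (q * nth 0 G j)@_m != 0 -> dep (mnm_supp m).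
  rewrite size_map => lt_j; rewrite (nth_map set0) //.
  have := mem_nth set0 lt_j; rewrite mem_enum inE depE => /existsP[u su].
  rewrite mulrC sq_monomialE => /mcoeffM_ex[m1 [m2 []]].
  rewrite -mcoeff_msupp => /mem_msuppXP<- _ ->.
  rewrite depE; apply/existsP; exists u; apply: subset_trans su _.
  exact: mnm_supp_mesym1D.
split=> [[v ->]|[coefs ep]].
  have ideal_sum (I : Type) (r : seq I) (P : pred I) (F : I -> S) :
      (forall x, P x -> in_ideal G (F x)) -> in_ideal G (\sum_(x <- r | P x) F x).
    move=> GF; apply: (big_ind (in_ideal G)) => // [|_ _ [c1 ->] [c2 ->]].
      by exists (fun=> 0); rewrite big1 // => x _; rewrite mul0r.
    exists (fun j => c1 j + c2 j); rewrite -big_split /=.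
    by apply: eq_bigr => j _; rewrite mulrDl.
  rewrite apply1 /boundary; apply: ideal_sum => a _.
  have memG : sq_monomial K (s a) \in G.
    by apply: map_f; rewrite mem_enum inE depE; apply/existsP; exists a.
  have lt_a : (index (sq_monomial K (s a)) G < size G)%N by rewrite index_mem.
  set q := v _; exists (fun j => if j == Ordinal lt_a then sgn a set0 *: q else 0).
  rewrite (bigD1 (Ordinal lt_a)) //= eqxx big1 => [|j /negPf->]; last by rewrite mul0r.
  rewrite nth_index // addr0 sq_monomialE union_suppU1 /union_supp big_set0 setU0.
  by rewrite -scalerAl mulrC.
have face0 : face set0 by have := mem_faces set0 0; rewrite faces0 inE eqxx =>
  /esym/andP[].
(* [p] becomes a chain on the empty face. Membership in the ideal puts some [s u] inside the support
   of each monomial, as [boundary_cone] requires. *)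
pose V A := if A == set0 then p else 0.
have suppV A m : face A -> #|A| = 0%N -> (V A)@_m != 0 ->
    union_supp A \subset mnm_supp m /\ exists u, s u \subset mnm_supp m.
  move=> _ /eqP; rewrite cards_eq0 => /eqP-> nz; split.
    by rewrite /union_supp big_set0 sub0set.
  apply/existsP; rewrite -depE; move: nz; rewrite /V eqxx ep raddf_sum /= => nz.
  have [j|all0] := pickP (fun j => (coefs j * nth 0 G j)@_m != 0); first exact: depG.
  by case/negP: nz; rewrite big1 // => j _; apply/eqP; rewrite -[_ == _]negbK all0.
exists (fun c => let A := nth set0 (faces 1) c in
  mdiv_mnm (mesym1 (union_supp A)) (cone V A)).
have cycV B : face B -> #|B|.+1 = 0%N -> boundary V B = 0 by [].
have := boundary_cone suppV cycV face0 (cards0 T); rewrite {2}/V eqxx apply1 => <-.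
apply: eq_boundary => a _; rewrite setU0 => fa.
rewrite nth_index ?mem_faces ?fa ?cards1 // mdiv_mnmK // => m nz; rewrite mesym1_le.
apply: (cone_supp fa _ nz) => b; rewrite inE => /eqP->; rewrite setDv => nzb.
by have [] := suppV _ _ face0 (cards0 T) nzb.
Qed.

(** As each new vertex of a face enlarges the support, nonzero entries have positive degree, which
    is minimality. *)
Lemma trans_complex_min_res (dep : pred {set 'I_n}) :
  (forall X, dep X = [exists u, s u \subset X]) ->
  (forall a B, a \notin B -> face (a |: B) -> ~~ (s a \subset union_supp B)) ->
  is_min_gr_res [seq sq_monomial K X | X <- enum [set X | dep X]] trans_complex.
Proof.
move=> depE strict; split; last 1 first.
- by case=> // i _; apply: trans_complex_exact.
- by rewrite /= faces0 /= /union_supp big_set0 cards0.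
- exists #|T| => i lt_i; rewrite /=; suff -> : faces i = [::] by [].
  case e: (faces i) => [//|A l]; have := mem_head A l.
  rewrite -e mem_faces => /andP[_ /eqP cA]; move: lt_i.
  by rewrite -cA ltnNge max_card.
- case=> // i r c _; rewrite /= !size_map => lt_r lt_c.
  rewrite !(nth_map set0) //; set B := nth set0 _ r; set A := nth set0 _ c.
  have fA : face A := (faces_nthP lt_c).1.
  split.
  + apply: rpred_sum => a /andP[_ /eqP->]; apply: rpredZ.
    rewrite dhomogX /= mdeg_mesym1 cardsD (setIidPr _) ?eqxx //.
    exact/union_suppS/subsetUr.
  + move=> nz; apply: subset_leq_card; apply: union_suppS.
    have [a /andP[_ /eqP->]|none] := pickP (fun a => (a \notin B) && (A == a |: B)).
      exact: subsetUr.
    by rewrite /trans_entry big_pred0 ?eqxx in nz.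
  + rewrite /trans_entry raddf_sum /= big1 // => a /andP[nBa /eqP eA].
    rewrite mcoeffZ mcoeffX; case: eqP => [e0|_]; last by rewrite mulr0.
    rewrite eA in fA; case/negP: (strict _ _ nBa fA).
    have := congr1 mdeg e0; rewrite mdeg_mesym1 mdeg0 => /eqP.
    by rewrite cards_eq0 setD_eq0 eA union_suppU1 subUset => /andP[].
- exact: trans_complex_ideal.
Qed.



End TransversalComplex.

(** * Counting the faces *)

Section GaussianBinomial.

Variable q : nat.
Hypothesis q_gt1 : (1 < q)%N.

Lemma qX_neq1 m : (q%:Q) ^+ m.+1 - 1 != 0.
Proof. by rewrite subr_eq0 -natrX pnatr_eq1 -(expn0 q) eqn_exp2l. Qed.

Lemma fqS m : fq m.+1 q = fq m q * (q%:Q ^+ m.+1 - 1).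
Proof. by rewrite /fq big_nat_recr. Qed.

Lemma fq_neq0 m : fq m q != 0.
Proof.
by elim: m => [|m IH]; [rewrite /fq big_nil oner_eq0 | rewrite fqS mulf_neq0 ?qX_neq1].
Qed.

Lemma gauss_binom0 m : gauss_binom m 0 q = 1.
Proof. by rewrite /gauss_binom subn0 {2}/fq big_nil mul1r divff ?fq_neq0. Qed.

Lemma gauss_binomn m : gauss_binom m m q = 1.
Proof. by rewrite /gauss_binom subnn {3}/fq big_nil mulr1 divff ?fq_neq0. Qed.

(** A q-analogue of Pascal's rule. For [i = m], truncated subtraction would make
    [gauss_binom m m.+1 q] nonzero. *)
Lemma gauss_binomS m i : (i < m)%N ->
  gauss_binom m.+1 i.+1 q = gauss_binom m i.+1 q + q%:Q ^+ (m - i) * gauss_binom m i q.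
Proof.
move=> lt_im; have [e ->] : exists e, m = (i + e.+1)%N.
  by exists (m - i.+1)%N; rewrite -addSnnS subnKC.
have eM : (i + e.+1 - i.+1 = e)%N by rewrite addnS subSS addKn.
rewrite /gauss_binom subSS addKn eM !fqS -addSn exprD.
set x := q%:Q ^+ i.+1; set y := q%:Q ^+ e.+1.
have := (fq_neq0 i, fq_neq0 e, qX_neq1 i, qX_neq1 e).
rewrite -/x -/y => -[[[nz1 nz2] nz3] nz4]; field.
by rewrite nz1 nz2 nz3 nz4.
Qed.

End GaussianBinomial.

Section CountFaces.

Variables (T : finType) (lev : T -> nat).

Definition faces_below m i : {set {set T}} :=
  [set A | [&& face lev A, #|A| == i & [forall a in A, (lev a < m)%N]]].

Lemma card_faces_below0 m : #|faces_below m 0| = 1%N.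
Proof.
apply/eqP/cards1P; exists set0; apply/setP => A; rewrite !inE cards_eq0.
case: (A =P set0) => [->|]; last by rewrite andbF.
by rewrite andTb; apply/andP; split; [apply/faceP => a|apply/forall_inP => a];
  rewrite inE.
Qed.

(** A face has at most one vertex of level [m], and removing it leaves a face below level [m]: the
    recursion of elementary symmetric functions of the level sizes. *)
Lemma card_faces_belowS m i : #|faces_below m.+1 i.+1| =
  (#|faces_below m i.+1| + #|[set a | lev a == m]| * #|faces_below m i|)%N.
Proof.
transitivity (\sum_(A in faces_below m.+1 i.+1)
    ((A \in faces_below m i.+1) + \sum_(a | lev a == m) (a \in A)))%N.
  rewrite -sum1_card; apply: eq_bigr => A; rewrite !inE =>
    /and3P[fA cA /forall_inP lt_A].
  rewrite fA cA /=; case: forall_inP => [lt_A'|ge_A].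
    by rewrite big1 // => a /eqP ea; apply/eqP; rewrite eqb0; apply/negP => /lt_A';
      rewrite ea ltnn.
  have [a /andP[Aa /eqP ea]|none] := pickP (fun a => (a \in A) && (lev a == m)).
    rewrite (bigD1 a) ?ea //= Aa big1 // => b /andP[/eqP eb nb].
    by apply/eqP; rewrite eqb0; apply: contraNN nb => Ab; apply/eqP;
      apply: (faceP _ _ fA); rewrite ?ea.
  case: ge_A => a Aa; have := none a; rewrite Aa /= ltn_neqAle => ->.
  exact: lt_A.
rewrite big_split /=; congr (_ + _)%N.
  rewrite -big_mkcondr /= sum1_card; apply: eq_card => A.
  apply/andP/idP => [[]//|memA]; split=> //; move: memA.
  rewrite !inE => /and3P[-> -> /forall_inP lt_A] /=.
  by apply/forall_inP => a /lt_A/ltnW.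
rewrite exchange_big /= -sum_nat_const big_mkcond [RHS]big_mkcond.
apply: eq_bigr => a _; rewrite inE; case: eqP => // ea.
have nB B : B \in faces_below m i -> a \notin B.
  rewrite !inE => /and3P[_ _ /forall_inP lt_B].
  by apply/negP => /lt_B; rewrite ea ltnn.
rewrite -(card_in_imset (f := fun B => a |: B)); last first.
  by move=> B B' /nB nBa /nB nBa' /(congr1 (fun B => B :\ a)); rewrite !setU1K.
rewrite -big_mkcondr /= sum1_card; apply: eq_card => A; apply/andP/imsetP.
  rewrite !inE => -[/and3P[fA cA /forall_inP lt_A] Aa].
  exists (A :\ a); rewrite ?setD1K // !inE faceD1 //=; apply/andP; split.
    by move: cA; rewrite (cardsD1 a) Aa.
  apply/forall_inP => b; rewrite !inE => /andP[nb Ab].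
  rewrite ltn_neqAle -ltnS lt_A // andbT -ea; apply: contraNneq nb =>
    /(faceP _ _ fA)->//.
case=> B memB ->; rewrite setU11; split=> //; have nBa := nB B memB.
move: memB; rewrite !inE => /and3P[fB /eqP cB /forall_inP lt_B].
rewrite cardsU1 nBa cB eqxx faceU1 //=; last by move=> b /lt_B; rewrite ea => + e;
  rewrite e ltnn.
by apply/forall_inP => b; rewrite !inE => /predU1P[->|/lt_B/ltnW//]; rewrite ea.
Qed.

Variables (q k : nat).
Hypotheses (q_gt1 : (1 < q)%N)
  (card_lev : forall m, (m < k)%N -> #|[set a | lev a == m]| = (q ^ m)%N).

Lemma faces_below_eq0 m i : (m < i)%N -> faces_below m i = set0.
Proof.
move=> lt_mi; apply/setP => A; rewrite !inE; apply/negP =>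
  /and3P[/faceP inj /eqP cA /forall_inP lt_A].
move: lt_mi; rewrite -cA ltnNge -(size_iota 0 m) cardE -(size_map lev) => /negP; apply.
apply: uniq_leq_size => [|l /mapP[a]].
  by rewrite map_inj_in_uniq ?enum_uniq // => a b; rewrite !mem_enum; apply: inj.
by rewrite mem_enum => /lt_A lt_a ->; rewrite mem_iota.
Qed.

Lemma card_faces_below m i : (i <= m <= k)%N ->
  (#|faces_below m i|)%:Q = gauss_binom m i q * q%:Q ^+ ((i * (i - 1)) %/ 2).
Proof.
elim: m i => [|m IH] [|i]; rewrite ?card_faces_below0 ?gauss_binom0 ?mulr1 //.
rewrite ltnS => /andP[le_im lt_mk].
have expE : ((i.+1 * (i.+1 - 1)) %/ 2 = i + (i * (i - 1)) %/ 2)%N.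
  by rewrite !divn2 !subn1 -!bin2 binS bin1 addnC.
rewrite expE card_faces_belowS card_lev // PoszD PoszM rmorphD rmorphM /= (IH i);
  last by rewrite le_im ltnW.
have -> : (q ^ m)%N%:~R = q%:Q ^+ (m - i) * q%:Q ^+ i :> rat.
  by rewrite -exprD subnK // -natrX.
(* For [i = m] Pascal's rule is replaced by the absence of faces with [m + 1] vertices below level
   [m]. *)
move: le_im; rewrite leq_eqVlt => /predU1P[->|lt_im].
  by rewrite faces_below_eq0 // cards0 !gauss_binomn // subnn add0r !mul1r exprD.
rewrite (IH i.+1); last by rewrite lt_im ltnW.
by rewrite expE gauss_binomS // exprD; ring.
Qed.

End CountFaces.

(** * Lines of a constant weight code *)

Section NormalizedVectors.

Variables (F : finFieldType) (k : nat).

(* A line of [F^k] is represented by its vector whose last nonzero coordinate is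
   1: the tag is the position of that coordinate, the function lists the
   coordinates before it. *)
Definition pnt : finType := {j : 'I_k & {ffun 'I_j -> F}}.

Definition top (t : pnt) : nat := tag t.

Definition pnt_vec (t : pnt) : 'rV[F]_k :=
  \row_l if insub (l : nat) is Some x then tagged t x else (l == tag t)%:R.

Lemma pnt_vec_top t : pnt_vec t 0 (tag t) = 1.
Proof. by rewrite mxE insubF ?ltnn // eqxx. Qed.

Lemma pnt_vec_above t (l : 'I_k) : (top t < l)%N -> pnt_vec t 0 l = 0.
Proof.
move=> lt_l; rewrite mxE insubF; last by rewrite ltnNge ltnW.
by rewrite -val_eqE /= gtn_eqF.
Qed.

(** Hence vectors of the same level differ only in coordinates below that level. *)
Lemma pnt_vec_ge t t' (l : 'I_k) : top t = top t' -> (top t <= l)%N ->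
  pnt_vec t 0 l = pnt_vec t' 0 l.
Proof.
move=> et; rewrite leq_eqVlt => /predU1P[el|lt_l]; last by rewrite !pnt_vec_above -?et.
have <- : tag t = l by apply: val_inj.
by rewrite pnt_vec_top (_ : tag t = tag t') ?pnt_vec_top //; apply: val_inj.
Qed.

Lemma pnt_vec_inj t t' : top t = top t' -> pnt_vec t = pnt_vec t' -> t = t'.
Proof.
case: t t' => [j f] [j' f'] /= /val_inj /= ej; subst j' => /rowP ev.
congr existT; apply/ffunP => x.
have lt_x : (x < k)%N := ltn_trans (ltn_ord x) (ltn_ord j).
by have := ev (Ordinal lt_x); rewrite !mxE /= valK.
Qed.

Lemma pnt_vec_ex (u : 'rV[F]_k) : u != 0 ->
  exists t, u = u 0 (tag t) *: pnt_vec t /\ u 0 (tag t) != 0.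
Proof.
move=> nz; have [j0 uj0] : exists j, u 0 j != 0.
  apply/existsP; apply: contraNT nz => /existsPn all0; apply/eqP/rowP => j.
  by rewrite mxE; apply/eqP; rewrite -[_ == _]negbK all0.
have [j uj max_j] := arg_maxnP (P := fun j => u 0 j != 0) (fun j => j : nat) uj0.
pose f : {ffun 'I_j -> F} :=
  [ffun x : 'I_j => u 0 (Ordinal (ltn_trans (ltn_ord x) (ltn_ord j))) / u 0 j].
exists (Tagged (fun j : 'I_k => {ffun 'I_j -> F}) f); split=> //=.
apply/rowP => l; rewrite !mxE /=; case: insubP => [x _ ex|].
  rewrite ffunE mulrC divfK //; congr (u _ _); exact: val_inj.
rewrite -leqNgt leq_eqVlt => /predU1P[/val_inj->|lt_l]; first by rewrite eqxx mulr1.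
rewrite -val_eqE /= gtn_eqF // mulr0; apply/eqP; apply: contraTT lt_l => /max_j.
by rewrite -leqNgt.
Qed.

Lemma card_top m : (m < k)%N -> #|[set t | top t == m]| = (#|F| ^ m)%N.
Proof.
move=> lt_m; pose j := Ordinal lt_m.
pose h (f : {ffun 'I_j -> F}) : pnt := Tagged (fun j : 'I_k => {ffun 'I_j -> F}) f.
have inj_h : injective h by move=> f f' /eqP; rewrite eq_Tagged => /eqP.
have -> : [set t | top t == m] = [set h f | f : {ffun 'I_j -> F}].
  apply/setP => t; rewrite inE; apply/eqP/imsetP => [|[f _ ->] //].
  case: t => [j' f] /= e; have ej : j' = j by apply: val_inj.
  by subst j'; exists f.
by rewrite card_imset // card_ffun card_ord.
Qed.

(** The vectors are in echelon form: at the highest level with a nonzero coefficient, the coordinate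
    sees one vector only. *)
Lemma pnt_vec_free m (e : 'I_m -> pnt) (a : 'rV[F]_m) : injective (top \o e) ->
  a *m \matrix_l pnt_vec (e l) = 0 -> a = 0.
Proof.
move=> inj e0; apply/rowP => l0; rewrite mxE; apply/eqP/negPn/negP => nz0.
have [l nz max_l] := arg_maxnP (P := fun l => a 0 l != 0) (top \o e) nz0.
have := congr1 (fun v : 'rV_k => v 0 (tag (e l))) e0.
rewrite mulmx_sum_row mxE summxE (bigD1 l) //= rowK.
rewrite mxE pnt_vec_top mulr1 big1 ?addr0 => [/eqP|l' ne]; first exact/negP.
rewrite rowK mxE; have [->|nz'] := eqVneq (a 0 l') 0; first by rewrite mul0r.
rewrite pnt_vec_above ?mulr0 // ltn_neqAle; apply/andP; split; last exact: max_l.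
by apply: contraNneq ne => /inj->.
Qed.

End NormalizedVectors.

(* [N] is a common value of the support sizes of subcodes of dimensions [i] and
   [i + 1], with [Q = q ^ i]. *)
Lemma no_equal_supp N d q Q : (0 < d)%N -> (1 < q)%N -> (0 < Q)%N ->
  (N * (Q * (q - 1)) = d * (Q - 1) * q)%N ->
  (N * (q * Q * (q - 1)) = d * (q * Q - 1) * q)%N -> False.
Proof.
move=> d_gt0 q_gt1 Q_gt0 e1 e2; have q_gt0 := ltnW q_gt1.
(* Eliminating [N] leaves [q * Q - 1 = q * Q - q], so [q = 1]. *)
have : (d * (q * Q - 1) * q = d * (Q - 1) * q * q)%N by rewrite -e1 -e2; ring.
move/eqP; rewrite eqn_pmul2r // -mulnA eqn_pmul2l // mulnBl mul1n [(Q * q)%N]mulnC.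
have le_q : (q <= q * Q)%N by rewrite leq_pmulr.
rewrite eqn_sub2lE // ?(leq_trans _ le_q) // => /eqP e.
by rewrite -e ltnn in q_gt1.
Qed.

(** * Supports of subcodes *)

Section ConstantWeight.

Variables (F : finFieldType) (n k d : nat) (g : 'M[F]_(k, n)).
Hypotheses (d_gt0 : (0 < d)%N)
  (const_wt : forall u : 'rV[F]_k, u != 0 -> wt (u *m g) = d).

Local Notation q := #|F|.
Implicit Types X : {set 'I_n}.

Definition vsupp (c : 'rV[F]_n) : {set 'I_n} := [set e | c 0 e != 0].

Definition pnt_supp (t : pnt F k) : {set 'I_n} := vsupp (pnt_vec t *m g).

Lemma vsuppZ a c : a != 0 -> vsupp (a *: c) = vsupp c.
Proof. by move=> nz; apply/setP => e; rewrite !inE mxE mulf_eq0 (negPf nz). Qed.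

Lemma pnt_supp_ex (u : 'rV[F]_k) X : u != 0 -> vsupp (u *m g) \subset X ->
  exists2 t, pnt_supp t \subset X & u 0 (tag t) != 0.
Proof.
case/pnt_vec_ex => t [eu nz] sub; exists t => //.
by move: sub; rewrite eu -scalemxAl vsuppZ.
Qed.

(** A line of lowest level works: a second one of that level would differ from it by a nonzero
    vector whose word is still supported in [X] and whose line has lower level. *)
Lemma pnt_apex_ex X t : pnt_supp t \subset X -> apex (@top F k) pnt_supp X != None.
Proof.
move=> sub; have [t0 sub0 min_t] := arg_minnP (P := fun t =>
  pnt_supp t \subset X) (@top F k) sub.
rewrite /apex; case: pickP => // /(_ t0); rewrite sub0 /=.
case: forallP => // -[] t1; apply/implyP => /andP[sub1 /eqP et].
apply/eqP/pnt_vec_inj => //; apply/eqP; rewrite -subr_eq0; apply/negPn/negP => nz.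
have [|t2 /min_t le_t nz2] := pnt_supp_ex (X := X) nz.
  rewrite mulmxBl; apply/subsetP => e; rewrite inE mxE [X in _ + X]mxE => nze.
  have [] : (pnt_vec t1 *m g) 0 e != 0 \/ (pnt_vec t0 *m g) 0 e != 0.
  - have [e0|] := eqVneq ((pnt_vec t1 *m g) 0 e) 0; last by left.
    by move: nze; rewrite e0 sub0r oppr_eq0; right.
  - by move=> nz1; apply: (subsetP sub1); rewrite inE.
  by move=> nz0; apply: (subsetP sub0); rewrite inE.
case/negP: nz2.
by rewrite mxE [X in _ + X]mxE (pnt_vec_ge (t' := t0)) ?subrr ?et.
Qed.

(** All fibres of a nonzero functional have the same size, by translation along [a0], where it takes
    the value 1. *)
Lemma card_nz_functional m (v : 'cV[F]_m) : v != 0 ->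
  (#|[set a : 'rV[F]_m | (a *m v != 0)%R]| * q = q ^ m * (q - 1))%N.
Proof.
move=> nz; pose N x := #|[set a : 'rV[F]_m | (a *m v) 0 0 == x]|.
have [a0 a01] : exists a0 : 'rV[F]_m, (a0 *m v) 0 0 = 1.
  have [l nzl] : exists l, v l 0 != 0.
    apply/existsP; apply: contraNT nz => /existsPn all0; apply/eqP/colP => l.
    by rewrite mxE; apply/eqP; rewrite -[_ == _]negbK all0.
  exists ((v l 0)^-1 *: delta_mx 0 l).
  by rewrite -scalemxAl -rowE !mxE mulVf.
have N0 x : N x = N 0.
  rewrite /N -(card_imset (f := fun a => a - x *: a0) _ (addIr _)).
  apply: eq_card => a; rewrite !inE; apply/imsetP/eqP => [[b]|e].
    by rewrite inE => /eqP eb ->;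
      rewrite mulmxBl -scalemxAl mxE eb [X in _ + X]mxE [X in - X]mxE a01 mulr1 subrr.
  exists (a + x *: a0);
    rewrite ?addrK // inE mulmxDl -scalemxAl mxE [X in _ + X]mxE a01 mulr1.
  by rewrite e add0r.
have eN : (q ^ m = q * N 0%R)%N.
  rewrite -sum_nat_const -[m in LHS]mul1n -(card_mx F 1 m) -sum1_card.
  rewrite (partition_big (fun a : 'rV_m => (a *m v) 0 0) xpredT) //=.
  by apply: eq_bigr => x _; rewrite sum1_card -(N0 x); apply: eq_card => a;
    rewrite !inE.
have -> : [set a : 'rV_m | a *m v != 0] = ~: [set a : 'rV_m | (a *m v) 0 0 == 0].
  apply/setP => a; rewrite !inE; congr (~~ _); apply/eqP/eqP => [->|e];
    first by rewrite mxE.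
  by apply/matrixP => i j; rewrite !ord1 e mxE.
rewrite cardsCs setCK card_mx mul1n -/(N 0) mulnBl mulnBr muln1.
by rewrite [(N 0%R * q)%N]mulnC -eN.
Qed.

Lemma card_union_supp (B : {set pnt F k}) : face (@top F k) B ->
  (#|union_supp pnt_supp B| * (q ^ #|B| * (q - 1)) = d * (q ^ #|B| - 1) * q)%N.
Proof.
move=> fB; pose e (l : 'I_#|B|) := enum_val l; pose M := \matrix_l pnt_vec (e l).
have inj_e : injective (@top F k \o e).
  by move=> l l' /(faceP _ _ fB) el; apply: enum_val_inj; apply: el; apply: enum_valP.
have colM x : (col x (M *m g) != 0) = (x \in union_supp pnt_supp B).
  apply/idP/bigcupP => [nz|[t Bt]].
    have [l nzl] : exists l, (M *m g) l x != 0.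
      apply/existsP; apply: contraNT nz => /existsPn all0; apply/eqP/colP => l.
      by rewrite !mxE; apply/eqP; rewrite -[_ == _]negbK; have := all0 l; rewrite mxE.
    exists (e l); first exact: enum_valP.
    by rewrite inE -(rowK (fun l => pnt_vec (e l)) l) -row_mul mxE.
  rewrite inE; apply: contra_neq => /colP/(_ (enum_rank_in Bt t)).
  rewrite mxE [RHS]mxE => <-; rewrite -[t in LHS](enum_rankK_in Bt Bt) -/(e _).
  by rewrite -(rowK (fun l => pnt_vec (e l))) -row_mul mxE.
(* Count by words: nonzero coefficients give nonzero words, by [pnt_vec_free]. *)
have <- : (\sum_(a : 'rV[F]_#|B| | (a != 0)%R) wt (a *m M *m g) = d * (q ^ #|B| - 1))%N.
  rewrite (eq_bigr (fun=> d)) => [|a nz]; last first.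
    by apply: const_wt; apply: contra_neq nz => /(pnt_vec_free inj_e).
  rewrite sum_nat_const mulnC; congr (_ * _)%N.
  by rewrite -[#|B| in RHS]mul1n -(card_mx F 1 #|B|) subn1 -(cardC1 (0 : 'rV[F]_#|B|)).
(* Count by coordinates: each one in the support is a nonzero functional. *)
transitivity (\sum_(x in union_supp pnt_supp B)
   #|[set a : 'rV[F]_#|B| | (a *m col x (M *m g) != 0)%R]| * q)%N.
  rewrite -sum_nat_const; apply: eq_bigr => x; rewrite -colM => nz.
  by rewrite card_nz_functional.
rewrite -big_distrl; congr (_ * _)%N => /=.
have wtE (a : 'rV[F]_#|B|) : wt (a *m M *m g) =
    (\sum_(x in union_supp pnt_supp B) (a *m col x (M *m g) != 0)%R)%N.
  rewrite /wt -sum1_card big_mkcond [RHS]big_mkcond; apply: eq_bigr => x _.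
  have eax : (a *m col x (M *m g) != 0) = ((a *m M *m g) 0 x != 0).
    have <- : col x (a *m M *m g) = a *m col x (M *m g) by rewrite !colE !mulmxA.
    congr (~~ _); apply/eqP/eqP => [/(congr1 (fun v : 'cV_1 => v 0 0))|e0].
      by rewrite mxE [RHS]mxE.
    by apply/colP => i; rewrite ord1 mxE e0 mxE.
  rewrite inE -eax -colM; have [->|_] := eqVneq (col x _) 0; last by case: (_ != _).
  by rewrite mulmx0 eqxx.
rewrite (eq_bigr _ (fun a _ => wtE a)) exchange_big /=; apply: eq_bigr => x _.
rewrite -sum1_card big_mkcond [RHS]big_mkcond; apply: eq_bigr => a _.
by rewrite inE; case: (a =P 0) => [->|_]; [rewrite mul0mx eqxx | case: (_ != _)].
Qed.

(** Otherwise subcodes of dimensions [#|B|] and [#|B| + 1] would have supports of the same size. *)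
Lemma pnt_supp_strict (t : pnt F k) (B : {set pnt F k}) :
  t \notin B -> face (@top F k) (t |: B) ->
    ~~ (pnt_supp t \subset union_supp pnt_supp B).
Proof.
move=> nBt ft; apply/negP => sub.
have := card_union_supp ft; have := card_union_supp (faceS (subsetUr [set t] B) ft).
rewrite union_suppU1 (setUidPr sub) cardsU1 nBt add1n.
rewrite expnS => e1 e2.
by apply: (no_equal_supp d_gt0 (finNzRing_gt1 F) _ e1 e2);
  rewrite expn_gt0 ltnW ?finNzRing_gt1.
Qed.

End ConstantWeight.

(** A relation among the columns in [X], extended by zero, is a kernel vector supported in [X]. *)
Lemma mat_indepPn (F : finFieldType) (m n : nat) (H : 'M[F]_(m, n)) (X : {set 'I_n}) :
  reflect (exists c : 'rV[F]_n, [/\ c != 0, c *m H^T = 0 & vsupp c \subset X])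
    (~~ mat_indep H X).
Proof.
pose s := [seq col j H | j <- enum X].
have size_s : size s = #|X| by rewrite size_map -cardE.
have sumE (a : 'I_n -> F) (j0 : 'I_n) r :
    (\sum_(i < size s) a (nth j0 (enum X) i) *: s`_i) r 0 = \sum_(j in X) a j * H r j.
  rewrite summxE -[RHS]big_enum [RHS](big_nth j0) [RHS]big_mkord -cardE -size_s.
  apply: eq_bigr => i _; rewrite (nth_map j0) ?mxE ?[in X in _ * X]mxE //.
  by rewrite -cardE -size_s.
have mulE (c : 'rV[F]_n) r : vsupp c \subset X ->
    (c *m H^T) 0 r = \sum_(j in X) c 0 j * H r j.
  move=> sub; rewrite mxE [RHS]big_mkcond; apply: eq_bigr => j _; rewrite mxE.
  case: ifPn => // nXj; apply/eqP; rewrite mulf_eq0; apply/orP; left.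
  by rewrite -[_ == _]negbK; apply: contraNN nXj => nz; apply: (subsetP sub);
    rewrite inE.
apply: (iffP idP) => [dep|[c [nz cH sub]]].
  have [/existsP[c /and3P[nz /eqP cH sub]]|/existsPn none] :=
    boolP [exists c : 'rV[F]_n, [&& c != 0, c *m H^T == 0 & vsupp c \subset X]].
    by exists c.
  case/negP: dep; rewrite /mat_indep -/s -[s]/(tval (in_tuple s)); apply/freeP =>
    a a0 i.
  pose j0 := enum_val (cast_ord size_s i).
  (* Reindexes the coefficients from positions in [enum X] to columns; the default 0 is not reached
     inside [X]. *)
  pose a' j := if insub (index j (enum X)) is Some l then a l else 0.
  have a'E (l : 'I_(size s)) : a' (nth j0 (enum X) l) = a l.
    by rewrite /a' index_uniq ?valK ?enum_uniq // -cardE -size_s.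
  pose c : 'rV_n := \row_j if j \in X then a' j else 0.
  have sub : vsupp c \subset X by apply/subsetP => j; rewrite inE mxE; case: ifP;
    rewrite ?eqxx.
  have cH : c *m H^T = 0.
    apply/rowP => r; rewrite mulE // mxE.
    transitivity (\sum_(j in X) a' j * H r j).
      by apply: eq_bigr => j Xj; rewrite mxE Xj.
    rewrite -(sumE a' j0); transitivity ((\sum_(l < size s) a l *: s`_l) r 0).
      by congr (fun_of_matrix _ r 0); apply: eq_bigr => l _; rewrite a'E.
    by rewrite a0 mxE.
  have := none c; rewrite cH eqxx sub andbT /= andbT negbK =>
    /eqP/rowP/(_ (nth j0 (enum X) i)).
  by rewrite !mxE a'E -mem_enum mem_nth // -cardE -size_s.
apply/negP; rewrite /mat_indep -/s -[s]/(tval (in_tuple s)) => /freeP free_s.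
have [j0 nz0] : exists j, c 0 j != 0.
  apply/existsP; apply: contraNT nz => /existsPn all0; apply/eqP/rowP => l.
  by rewrite mxE; apply/eqP; rewrite -[_ == _]negbK all0.
have Xj0 : j0 \in enum X by rewrite mem_enum (subsetP sub) ?inE.
have lt_j0 : (index j0 (enum X) < size s)%N by rewrite size_s cardE index_mem.
have := free_s (fun i => c 0 (nth j0 (enum X) i)) _ (Ordinal lt_j0).
rewrite /= nth_index // => c0; rewrite c0 ?eqxx // in nz0.
by apply/colP => r; rewrite sumE -mulE // cH !mxE.
Qed.

Lemma degree_formula N d q i : (1 < q)%N ->
  (N * (q ^ i.+1 * (q - 1)) = d * (q ^ i.+1 - 1) * q)%N ->
  N%:Q = d%:Q * (q%:Q ^+ i.+1 - 1) / (q%:Q ^+ (i.+1 - 1) * (q%:Q - 1)).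
Proof.
move=> q_gt1 e; have nz1 : q%:Q - 1 != 0 by have := qX_neq1 q_gt1 0; rewrite expr1.
have nzq : q%:Q != 0 by rewrite pnatr_eq0 -lt0n ltnW.
have q_gt0 := ltnW q_gt1.
have := congr1 (fun m : nat => m%:R : rat) e.
rewrite !natrM !natrB ?expn_gt0 ?q_gt0 // !natrX subn1 /= exprS.
have nzX := expf_neq0 i nzq; move: nz1 nzq nzX; rewrite -!pmulrn.
set x := q%:R; set y := x ^+ i => nz1 nzq nzX e'.
apply: (mulIf (mulf_neq0 nzq (mulf_neq0 nzX nz1))).
transitivity (d%:R * (x * y - 1) * x); first by rewrite -e'; ring.
by field; apply/andP.
Qed.

Theorem theorem2 (F : finFieldType) (n k d : nat)
    (C : {vspace 'rV[F]_n}) (H : 'M[F]_(n - k, n)) (K : fieldType) :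
  \dim C = k -> (1 <= k)%N ->
  (forall c : 'rV[F]_n, c \in C -> c != 0 -> wt c = d) ->
  (forall c : 'rV[F]_n, (c \in C) = (c *m H^T == 0)) ->
  let q := #|F| in
  (exists P : gr_complex K n, is_min_gr_res (SR_gens K H) P) /\
  (forall P : gr_complex K n, is_min_gr_res (SR_gens K H) P ->
     (forall i, (1 <= i <= k)%N ->
        (size (shifts P i))%:Q = gauss_binom k i q * (q%:Q) ^+ ((i * (i - 1)) %/ 2) /\
        (forall e, e \in shifts P i ->
           e%:Q = d%:Q * ((q%:Q) ^+ i - 1) / ((q%:Q) ^+ (i - 1) * (q%:Q - 1)))) /\
     (forall i, (k < i)%N -> shifts P i = [::])).
Proof.
move=> dimC k_gt0 const_wt HC q.
have q_gt1 : (1 < q)%N := finNzRing_gt1 F.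
(* A generator matrix, which identifies [F^k] with [C]. *)
pose g : 'M[F]_(k, n) := \matrix_(i < k) (vbasis C)`_i.
have mulgE (u : 'rV[F]_k) : u *m g = \sum_(i < k) u 0 i *: (vbasis C)`_i.
  by rewrite mulmx_sum_row; apply: eq_bigr => i _; rewrite rowK.
have gC u : u *m g \in C.
  rewrite mulgE; apply: memv_suml => i _; apply: memvZ; apply: vbasis_mem.
  by apply: mem_nth; rewrite size_tuple dimC.
have g_inj (u : 'rV[F]_k) : u != 0 -> u *m g != 0.
  apply: contra_neq => e0; rewrite mulgE in e0; apply/rowP => i.
  have := basis_free (vbasisP C); move: (vbasis C) e0; rewrite dimC =>
    X e0 /freeP free_X.
  by rewrite mxE; apply: (free_X (fun i => u 0 i)).
have g_surj (c : 'rV[F]_n) : c \in C -> exists u, c = u *m g.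
  move=> /coord_vbasis ec; exists (\row_i coord (vbasis C) (cast_ord (esym dimC) i) c).
  rewrite mulgE {1}ec (reindex (cast_ord (esym dimC))) /=; last first.
    by exists (cast_ord dimC) => i _; rewrite ?cast_ordK ?cast_ordKV.
  by apply: eq_bigr => i _; rewrite mxE.
have wt_g (u : 'rV[F]_k) : u != 0 -> wt (u *m g) = d by move=> /g_inj; apply: const_wt.
have d_gt0 : (0 < d)%N.
  have nz : delta_mx 0 (Ordinal k_gt0) != 0 :> 'rV[F]_k.
    by apply/eqP => /rowP/(_ (Ordinal k_gt0)); rewrite !mxE !eqxx => /eqP;
      rewrite oner_eq0.
  rewrite -(wt_g _ nz) card_gt0; apply: contraNneq (g_inj _ nz) => e0.
  apply/eqP/rowP => j; rewrite [RHS]mxE; apply/eqP; rewrite -[_ == _]negbK.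
  by have := in_set0 j; rewrite -e0 inE => ->.
have depE X : ~~ mat_indep H X = [exists t, pnt_supp g t \subset X].
  apply/mat_indepPn/existsP => [[c [nz cH sub]]|[t sub]].
    have [u eu] : exists u, c = u *m g by apply: g_surj; rewrite HC cH.
    have [||t] := @pnt_supp_ex _ _ _ g u X; last by exists t.
      by apply: contraNneq nz => u0; rewrite eu u0 mul0mx.
    by rewrite -eu.
  exists (pnt_vec t *m g); split=> //; last by apply/eqP; rewrite -HC.
  apply: g_inj; apply/eqP => /rowP/(_ (tag t)); rewrite pnt_vec_top mxE => /eqP.
  by rewrite oner_eq0.
pose P0 := trans_complex K (@top F k) (pnt_supp g).
have resP0 : is_min_gr_res (SR_gens K H) P0.
  apply: trans_complex_min_res depE _ => //.
    by move=> X t; apply: pnt_apex_ex.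
  by move=> t B; apply: pnt_supp_strict d_gt0 wt_g _ _.
(* All levels are below [k], so [faces_below] at [k] misses no face. *)
have size_P0 i : size (shifts P0 i) = #|faces_below (@top F k) k i|.
  rewrite size_map -cardE; apply: eq_card => A; rewrite !inE; case: face;
    case: eqP => //= _.
  by apply/esym/forall_inP => t _; apply: ltn_ord.
split; first by exists P0.
(* Inclusion of the shifts in those of [P0] suffices, as in each step these all coincide. *)
move=> P resP; split=> [i /andP[i_gt0 le_ik]|i lt_ki].
  have [size_P sub_P] := min_res_shifts resP resP0 i; split.
    rewrite size_P size_P0 (card_faces_below q_gt1 (@card_top F k)) //.
    by rewrite le_ik leqnn.
  move=> e /sub_P /mapP[A]; rewrite mem_faces => /andP[fA /eqP cA] ->.
  have := card_union_supp wt_g fA; rewrite cA.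
  by case: i i_gt0 {le_ik size_P sub_P cA} => // i _; apply: degree_formula.
apply/nilP; rewrite /nilp (min_res_shifts resP resP0 i).1 size_P0.
by rewrite faces_below_eq0 ?cards0.
Qed.
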